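(* Let $C_2$ be a projective primitive double curve with associated reduced curve $C$, write $\mathcal{O}_2=\mathcal{O}_{C_2}$, and let $P\in C$ be a closed point. Let $M$ be a finitely generated torsion free $\mathcal{O}_{2,P}$-module. Then there exist integers $m,q\ge 0$ and a finite (possibly empty) sequence of positive integers $n_1,\dots,n_p$ such that $$M\simeq\Bigl(\bigoplus_{i=1}^p I_{n_i,P}\Bigr)\oplus m\,\mathcal{O}_{2,P}\oplus q\,\mathcal{O}_{C,P},$$ where $m\,\mathcal{O}_{2,P}$ and $q\,\mathcal{O}_{C,P}$ denote direct sums of $m$, resp. $q$, copies.
   Context: Everything is over $\mathbb{C}$. A projective primitive double curve $C_2$ with reduced curve $C$: $C$ is a smooth irreducible projective curve in a smooth connected threefold $X$, $C_2\subset X$ is a closed Cohen–Macaulay subscheme with $(C_2)_{red}=C$ such that near each closed point $P\in C$ it is contained in a surface smooth at $P$, and its multiplicity is $2$: the ideal sheaf $\mathcal{I}_C$ of $C$ in $C_2$ is nonzero, locally generated by one element, and $\mathcal{I}_C^2=0$. Let $z\in\mathcal{O}_{2,P}$ be a generator of the ideal of $C$, and $x\in\mathcal{O}_{2,P}$ an element over a generator of the maximal ideal of $\mathcal{O}_{C,P}$. For every integer $k\geq 1$, $I_{k,P}$ denotes the ideal $(x^k,z)\subset\mathcal{O}_{2,P}$. A finitely generated $\mathcal{O}_{2,P}$-module is torsion free if it has no nonzero submodule of finite length. *)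

(* Defs.v *)
From HB Require Import structures.
From mathcomp Require Import all_boot all_order all_algebra.
From mathcomp Require Import boolp classical_sets functions reals topology.
From mathcomp Require Import complex.
From mathcomp Require Import -(notations) mpoly.

Set Implicit Arguments.
Unset Strict Implicit.
Unset Printing Implicit Defensive.

Import GRing.Theory.
Local Open Scope classical_set_scope.
Local Open Scope ring_scope.

(** * Commutative algebra *)

(* Rings of sections may be zero (over the empty open set), hence the use of
   [comPzRingType]; ideals are [Prop]-valued sets since membership is not
   decidable. *)
Section CommutativeAlgebra.
Variable A : comPzRingType.
Implicit Types (I J : set A) (s : seq A) (a b : A) (d n : nat).

Definition invertible a : Prop := exists b, a * b = 1.

Definition nilpotent a : Prop := exists n, a ^+ n = 0.

Definition is_ideal I : Prop :=
  [/\ I 0, forall a b, I a -> I b -> I (a + b) & forall a b, I b -> I (a * b)].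

Definition is_prime I : Prop :=
  [/\ is_ideal I, ~ I 1 & forall a b, I (a * b) -> I a \/ I b].

Definition ideal_gen s : set A :=
  [set a | exists c : 'I_(size s) -> A, a = \sum_(i < size s) c i * s`_i].

Definition noetherian : Prop := forall I, is_ideal I -> exists s, I = ideal_gen s.

Definition nonunits : set A := [set a | ~ invertible a].

(* When this holds, [nonunits] is the maximal ideal. *)
Definition is_local : Prop := is_ideal nonunits.

Definition prime_chain n : Prop :=
  exists p : nat -> set A,
    (forall i, (i <= n)%N -> is_prime (p i)) /\
    (forall i, (i < n)%N -> p i `<` p i.+1).

Definition krull_dim n : Prop := prime_chain n /\ ~ prime_chain n.+1.

Definition regular_local d : Prop :=
  [/\ is_local, noetherian, krull_dim d
    & exists2 s, size s = d & nonunits = ideal_gen s].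

(* Only used for a local ring: the quotient by [s] is then automatically
   nonzero, as [s] consists of nonunits. *)
Definition regular_seq s : Prop :=
  (forall a, a \in s -> nonunits a) /\
  (forall i, (i < size s)%N ->
     forall a, ideal_gen (take i s) (s`_i * a) -> ideal_gen (take i s) a).

Definition depth d : Prop :=
  (exists2 s, size s = d & regular_seq s) /\
  (forall s, regular_seq s -> (size s <= d)%N).

Definition cohen_macaulay_local : Prop :=
  [/\ is_local, noetherian & exists2 d, krull_dim d & depth d].

End CommutativeAlgebra.

Arguments noetherian : clear implicits.
Arguments nonunits : clear implicits.
Arguments is_local : clear implicits.
Arguments krull_dim : clear implicits.
Arguments regular_local : clear implicits.
Arguments depth : clear implicits.
Arguments cohen_macaulay_local : clear implicits.

Section Modules.
Variables (A : comNzRingType) (M : lmodType A).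
Implicit Types (N : set M).

Definition finitely_generated : Prop :=
  exists n (g : 'I_n -> M),
    forall v, exists c : 'I_n -> A, v = \sum_(i < n) c i *: g i.

Definition is_submodule N : Prop :=
  [/\ N 0, forall u v, N u -> N v -> N (u + v) & forall a u, N u -> N (a *: u)].

(* The lengths of the strict chains of submodules of [N] are bounded. *)
Definition finite_length N : Prop :=
  exists n, forall r (L : nat -> set M),
    (forall i, (i <= r)%N -> is_submodule (L i) /\ L i `<=` N) ->
    (forall i, (i < r)%N -> L i `<` L i.+1) ->
    (r <= n)%N.

Definition torsion_free : Prop :=
  forall N, is_submodule N -> finite_length N -> N = [set 0].

End Modules.

Arguments finitely_generated {A} M.
Arguments torsion_free {A} M.

Definition restrict_scalars (A B : comNzRingType) (f : {rmorphism A -> B}) : Type := B.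

Section RestrictScalars.
Variables (A B : comNzRingType) (f : {rmorphism A -> B}).

HB.instance Definition _ := GRing.Zmodule.copy (restrict_scalars f) B.

Definition rs_scale (a : A) (b : restrict_scalars f) : restrict_scalars f :=
  f a * (b : B).

Fact rs_scalerA a b v : rs_scale a (rs_scale b v) = rs_scale (a * b) v.
Proof. by rewrite /rs_scale rmorphM mulrA. Qed.

Fact rs_scale1r : left_id 1 rs_scale.
Proof. by move=> v; rewrite /rs_scale rmorph1 mul1r. Qed.

Fact rs_scalerDr : right_distributive rs_scale +%R.
Proof. by move=> a u v; rewrite /rs_scale mulrDr. Qed.

Fact rs_scalerDl v : {morph rs_scale^~ v : a b / a + b}.
Proof. by move=> a b; rewrite /rs_scale rmorphD mulrDl. Qed.

HB.instance Definition _ := GRing.Zmodule_isLmodule.Build A (restrict_scalars f)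
  rs_scalerA rs_scale1r rs_scalerDr rs_scalerDl.

(* [M] is isomorphic to the direct sum of the ideals [I l], of [m] copies of
   [A] and of [q] copies of [B]; this direct sum is realized as a submodule of
   A^p + A^m + B^q. *)
Definition isom_direct_sum (M : lmodType A) p (I : 'I_p -> set A) m q : Prop :=
  exists phi : {linear M -> ({ffun 'I_p -> A^o} * {ffun 'I_m -> A^o} *
                             {ffun 'I_q -> restrict_scalars f})%type},
    injective phi /\
    range phi = [set w | forall l, I l ((w.1.1 : {ffun 'I_p -> A^o}) l)].

End RestrictScalars.

(** * Locally ringed spaces over a field *)

Record openset (T : topologicalType) := Openset {
  oset :> set T;
  osetP : open oset }.

Definition oset_pred (T : topologicalType) (U : openset T) : T -> Prop := oset U.
Coercion oset_pred : openset >-> Funclass.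

Section OpenSets.
Variable T : topologicalType.

Definition osetI (U V : openset T) : openset T :=
  Openset (openI (osetP U) (osetP V)).

Definition osetIl (U V : openset T) : osetI U V `<=` U := @subIsetl T U V.
Definition osetIr (U V : openset T) : osetI U V `<=` V := @subIsetr T U V.

End OpenSets.

Definition open_preim (S T : topologicalType) (f : S -> T) (cf : continuous f)
    (U : openset T) : openset S :=
  Openset ((continuousP f).1 cf U (osetP U)).

(* The sheaf of [k]-algebras [sec] comes with its stalks: [germ_surj] and
   [germ_eq] say that [stalk x] is the colimit of the [sec U] over the open
   neighbourhoods [U] of [x], so that [stalk] and [germ] are determined by
   [sec] up to unique isomorphism. *)
Record lrSpace (k : fieldType) := LRSpace {
  carrier :> topologicalType;
  sec : openset carrier -> comPzRingType;
  scal : forall U, {rmorphism k -> sec U};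
  res : forall U V : openset carrier, V `<=` U -> {rmorphism sec U -> sec V};
  res_id : forall (U : openset carrier) (h : U `<=` U) (s : sec U), res h s = s;
  res_comp : forall (U V W : openset carrier)
    (h : V `<=` U) (h' : W `<=` V) (h'' : W `<=` U) (s : sec U),
    res h' (res h s) = res h'' s;
  res_scal : forall (U V : openset carrier) (h : V `<=` U) (c : k),
    res h (scal U c) = scal V c;
  sheafP : forall (I : Type) (U : openset carrier) (V : I -> openset carrier)
    (h : forall i, V i `<=` U) (s : forall i, sec (V i)),
    (forall x, U x -> exists i, V i x) ->
    (forall i j, res (@osetIl _ (V i) (V j)) (s i) =
                 res (@osetIr _ (V i) (V j)) (s j)) ->
    exists! t : sec U, forall i, res (h i) t = s i;
  stalk : carrier -> comNzRingType;
  germ : forall (U : openset carrier) (x : carrier),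
    U x -> {rmorphism sec U -> stalk x};
  germ_res : forall (U V : openset carrier) (h : V `<=` U) (x : carrier)
    (Ux : U x) (Vx : V x) (s : sec U), germ Vx (res h s) = germ Ux s;
  germ_surj : forall x (a : stalk x),
    exists (U : openset carrier) (Ux : U x) (s : sec U), germ Ux s = a;
  germ_eq : forall (U : openset carrier) x (Ux : U x) (s t : sec U),
    germ Ux s = germ Ux t ->
    exists (V : openset carrier) (h : V `<=` U), V x /\ res h s = res h t;
  stalk_local : forall x, is_local (stalk x) }.

Arguments sec {k} l U.
Arguments scal {k l} U.
Arguments res {k l U V} h.
Arguments stalk {k} l x.
Arguments germ {k l U x} Ux.

Record lrMorphism (k : fieldType) (Y X : lrSpace k) := LRMorphism {
  mapping :> Y -> X;
  mapping_cont : continuous mapping;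
  pull : forall U : openset X,
    {rmorphism sec X U -> sec Y (open_preim mapping_cont U)};
  pull_scal : forall (U : openset X) (c : k), pull U (scal U c) = scal _ c;
  pull_res : forall (U V : openset X) (h : V `<=` U)
    (h' : open_preim mapping_cont V `<=` open_preim mapping_cont U) (s : sec X U),
    pull V (res h s) = res h' (pull U s);
  stalk_map : forall y : Y, {rmorphism stalk X (mapping y) -> stalk Y y};
  stalk_map_germ : forall (U : openset X) (y : Y) (Uy : U (mapping y))
    (Uy' : open_preim mapping_cont U y) (s : sec X U),
    stalk_map y (germ Uy s) = germ Uy' (pull U s);
  stalk_map_local : forall y (a : stalk X (mapping y)),
    invertible (stalk_map y a) -> invertible a }.

Arguments pull {k Y X} f U : rename.
Arguments stalk_map {k Y X} f y : rename.

(** * Schemes *)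

Section Schemes.
Variable k : fieldType.
Implicit Types (X Y : lrSpace k).

Definition nonvanishing X (U : openset X) (f : sec X U) : set X :=
  [set x | exists Ux : U x, invertible (germ Ux f)].

(* The canonical morphism from [U] to the spectrum of [sec X U], which sends
   [x] to the prime ideal of the sections vanishing at [x], is an isomorphism:
   it is bijective, the topology of [U] is generated by the sets
   [nonvanishing f], and restricting to [nonvanishing f] is localizing at
   [f]. *)
Definition affine_open X (U : openset X) : Prop :=
  [/\ forall p : set (sec X U), is_prime p ->
        exists! x, exists Ux : U x, p = [set f | ~ invertible (germ Ux f)],
      forall (V : openset X) x, V `<=` U -> V x ->
        exists f : sec X U, nonvanishing f x /\ nonvanishing f `<=` V
    & forall (f : sec X U) (V : openset X) (h : V `<=` U),
        V = nonvanishing f :> set X ->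
        [/\ invertible (res h f),
            forall t : sec X V, exists a n, t * res h f ^+ n = res h a
          & forall a, res h a = 0 -> exists n, f ^+ n * a = 0]].

Definition is_scheme X : Prop :=
  forall x : X, exists2 U : openset X, U x & affine_open U.

Local Notation polyalg n := (mpoly n k).
Local Notation polyX i := (mpolyX k (mnm1 i)).

Definition algebra_fg X (U : openset X) : Prop :=
  exists n (phi : {rmorphism polyalg n -> sec X U}),
    (forall c, phi (mpolyC n c) = scal U c) /\
    (forall s, exists p, phi p = s).

Definition finite_type X : Prop :=
  compact [set: X] /\
  forall x : X, exists U : openset X, [/\ U x, affine_open U & algebra_fg U].

(* For two affine open sets [U] and [V], the morphism from the intersection of
   [U] and [V] to their product is a closed immersion. *)
Definition is_separated X : Prop :=
  forall U V : openset X, affine_open U -> affine_open V ->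
    affine_open (osetI U V) /\
    forall t : sec X (osetI U V),
      exists n (a : 'I_n -> sec X U) (b : 'I_n -> sec X V),
        t = \sum_(i < n) res (@osetIl _ U V) (a i) * res (@osetIr _ U V) (b i).

Definition irreducible_space (T : topologicalType) : Prop :=
  [set: T] !=set0 /\
  forall U V : set T, open U -> open V -> U !=set0 -> V !=set0 ->
    U `&` V !=set0.

Definition closed_point (T : topologicalType) (x : T) : Prop := closed [set x].

Definition reduced X : Prop :=
  forall (x : X) (a : stalk X x), nilpotent a -> a = 0.

Definition cohen_macaulay X : Prop :=
  forall x : X, cohen_macaulay_local (stalk X x).

(* Over a perfect field, a scheme of finite type is smooth exactly where its
   local rings are regular. *)
Definition smooth_of_dim (d : nat) X : Prop :=
  forall x : X, closed_point x -> regular_local (stalk X x) d.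

(* [f] is an immersion whose image is a closed subset of [V], i.e. a closed
   immersion into the open subspace [V] of [X]. *)
Definition closed_immersion_into Y X (f : lrMorphism Y X) (V : openset X) : Prop :=
  [/\ injective f,
      forall y, V (f y),
      forall F : set Y, closed F ->
        exists2 G : set X, closed G & f @` F = G `&` V
    & forall y (b : stalk Y y), exists a, stalk_map f y a = b].

Definition closed_immersion Y X (f : lrMorphism Y X) : Prop :=
  closed_immersion_into f (Openset openT).

(* [Pr] is glued from the affine spaces [U i], where [t i j] is the quotient
   x_j / x_i of homogeneous coordinates. *)
Definition is_projective_space (n : nat) (Pr : lrSpace k) : Prop :=
  exists (U : 'I_n.+1 -> openset Pr) (t : forall i, 'I_n.+1 -> sec Pr (U i)),
    [/\ forall x, exists i, U i x,
        forall i, affine_open (U i),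
        forall i, t i i = 1 /\
          exists phi : {rmorphism polyalg n -> sec Pr (U i)},
            [/\ bijective phi,
                forall c, phi (mpolyC n c) = scal (U i) c
              & forall j : 'I_n, phi (polyX j) = t i (lift i j)],
        forall i j, U i `&` U j = nonvanishing (t i j)
      & forall i j l x (Ui : U i x) (Uj : U j x),
          germ Ui (t i l) = germ Ui (t i j) * germ Uj (t j l)].

Definition projective Y : Prop :=
  exists n (Pr : lrSpace k) (f : lrMorphism Y Pr),
    is_projective_space n Pr /\ closed_immersion f.

(** * Primitive double curves *)

Definition smooth_connected_threefold X : Prop :=
  [/\ is_scheme X, finite_type X, is_separated X, smooth_of_dim 3 X
    & connected [set: X]].

Definition smooth_irreducible_projective_curve C : Prop :=
  [/\ is_scheme C, projective C, smooth_of_dim 1 C & irreducible_space C].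

(* The stalk at [i y] of the ideal sheaf defining the closed subspace [Y]. *)
Definition ideal_stalk Y X (i : lrMorphism Y X) (y : Y) : set (stalk X (i y)) :=
  [set a | stalk_map i y a = 0].

Arguments ideal_stalk {Y X} i y.

(* [C] is the reduced subscheme of [C2]. *)
Definition is_reduction C C2 (i : lrMorphism C C2) : Prop :=
  [/\ closed_immersion i, forall y, exists x, i x = y & reduced C].

(* Near [P], the subscheme [C2] of [X] is contained in a surface [S], closed in
   the open set [V] and smooth at [P]; the inclusion of subschemes of [V] is
   the reverse inclusion of their ideal sheaves. *)
Definition in_smooth_surface_near C2 X (j : lrMorphism C2 X) (P : X) : Prop :=
  exists (V : openset X) (S : lrSpace k) (h : lrMorphism S X),
    [/\ V P, is_scheme S, closed_immersion_into h V,
        exists2 s, h s = P & regular_local (stalk S s) 2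
      & forall (U : openset X) (f : sec X U), U `<=` V ->
          pull h U f = 0 -> pull j U f = 0].

Definition multiplicity_two C C2 (i : lrMorphism C C2) : Prop :=
  [/\ exists (U : openset C2) (f : sec C2 U), pull i U f = 0 /\ f <> 0,
      forall x : C, exists (U : openset C2) (z : sec C2 U), U (i x) /\
        forall (y : C) (Uy : U (i y)),
          ideal_stalk i y = ideal_gen [:: germ Uy z]
    & forall (x : C) (a b : stalk C2 (i x)),
        ideal_stalk i x a -> ideal_stalk i x b -> a * b = 0].

Definition projective_primitive_double_curve
    C C2 X (i : lrMorphism C C2) (j : lrMorphism C2 X) : Prop :=
  [/\ smooth_connected_threefold X /\ smooth_irreducible_projective_curve C,
      [/\ is_scheme C2, closed_immersion j & cohen_macaulay C2],
      is_reduction i,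
      forall P : C, closed_point P -> in_smooth_surface_near j (j (i P))
    & multiplicity_two i].

End Schemes.

Arguments ideal_stalk {k Y X} i y.

(* Main.v *)
From HB Require Import structures.
Require Import Defs.
From mathcomp Require Import all_boot all_order all_algebra.
From mathcomp Require Import boolp classical_sets functions reals topology.
From mathcomp Require Import complex.
From mathcomp Require Import -(notations) mpoly.
From mathcomp Require Import ring.

Set Implicit Arguments.
Unset Strict Implicit.
Unset Printing Implicit Defensive.

Import GRing.Theory.
Local Open Scope classical_set_scope.
Local Open Scope ring_scope.

(** Let [A] and [B] be the local rings of [C2] and [C] at [P]. Since [B] is a
    discrete valuation ring, every element of [A] outside the kernel [(z)] of
    [A -> B] is [x ^+ n * u + c * z] with [u] a unit; as [A] is Cohen-Macaulay
    of positive dimension, [x] is regular on [A], so that either [z = 0] or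
    the annihilator of [z] is [(z)]. If [M] is torsion free, [x] is also
    regular on [M], and the kernel [N] of [z] on [M] is a free [B]-module. The
    Smith normal form of [z : M -> N] gives a basis [h] of [N] and elements
    [e j] of [M] with [z *: e j = x ^+ n_j *: h j] that together with [N]
    generate [M]. Then [A e_j + A h_j] is isomorphic to the ideal
    [(x ^+ n_j, z)], which is [A] when [n_j = 0], and each remaining [h j]
    contributes a copy of [B]. *)

(** * Least integers and ideals with given generators *)

Lemma exists_minimal (Q : nat -> Prop) :
  (exists n, Q n) -> exists2 n, Q n & forall k, (k < n)%N -> ~ Q k.
Proof.
move=> [n Qn]; have exQ : exists n, `[< Q n >] by exists n; apply/asboolP.
have [k /asboolP Qk mink] := ex_minnP exQ; exists k => // l ltlk Ql.
by have /mink := asboolT Ql; rewrite leqNgt ltlk.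
Qed.

Section Generators.
Variable A : comPzRingType.
Implicit Types a b : A.

Lemma ideal_gen1P a b : ideal_gen [:: a] b <-> exists c, b = c * a.
Proof.
split=> [[c ->]|[c ->]]; first by exists (c ord0); rewrite big_ord1.
by exists (fun=> c); rewrite big_ord1.
Qed.

Lemma ideal_gen2P a1 a2 b :
  ideal_gen [:: a1; a2] b <-> exists c1 c2, b = c1 * a1 + c2 * a2.
Proof.
split=> [[c ->]|[c1 [c2 ->]]].
  by exists (c ord0), (c (lift ord0 ord0)); rewrite big_ord_recl big_ord1.
exists (fun i : 'I_2 => if i == ord0 then c1 else c2).
by rewrite big_ord_recl big_ord1.
Qed.

Lemma nonunitsN1 : ~ nonunits A 1.
Proof. by apply; exists 1; rewrite mulr1. Qed.

Lemma nonunitsM a b : nonunits A b -> nonunits A (a * b).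
Proof. by move=> nb [c abc]; apply: nb; exists (a * c); rewrite mulrCA mulrA. Qed.

Lemma prime_nonunits I : is_prime I -> I `<=` nonunits A.
Proof.
by move=> [[_ _ IM] I1 _] a Ia [b ab]; apply: I1; rewrite -ab mulrC; apply: IM.
Qed.

End Generators.

(** * Spans, Nakayama's lemma and submodules over noetherian rings *)

Section LinearSpan.
Variables (A : comNzRingType) (M : lmodType A).
Implicit Types (N : set M) (v w : M) (a : A).

Definition lspan s (h : 'I_s -> M) : set M :=
  [set v | exists a : 'I_s -> A, v = \sum_j a j *: h j].

Lemma lspan_submodule s (h : 'I_s -> M) : is_submodule (lspan h).
Proof.
split.
- by exists (fun=> 0); rewrite big1 // => j _; rewrite scale0r.
- move=> _ _ [a ->] [b ->]; exists (fun j => a j + b j).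
  by rewrite -big_split /=; apply: eq_bigr => j _; rewrite scalerDl.
- move=> a _ [b ->]; exists (fun j => a * b j).
  by rewrite scaler_sumr; apply: eq_bigr => j _; rewrite scalerA.
Qed.

Lemma submodule_sum N s (a : 'I_s -> A) (h : 'I_s -> M) :
  is_submodule N -> (forall j, N (h j)) -> N (\sum_j a j *: h j).
Proof.
move=> [N0 ND NZ] Nh; elim/big_rec: _ => // j v _ Nv.
by apply: ND => //; apply: NZ.
Qed.

Lemma submoduleB N v w : is_submodule N -> N v -> N w -> N (v - w).
Proof. by move=> [_ ND NZ] Nv Nw; apply: ND => //; rewrite -scaleN1r; apply: NZ. Qed.

Lemma lspan_mem s (h : 'I_s -> M) j : lspan h (h j).
Proof.
exists (fun k => (k == j)%:R).
rewrite (bigD1 j) //= eqxx scale1r big1 ?addr0 // => k /negbTE ->.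
by rewrite scale0r.
Qed.

Lemma lspan_sub N s (h : 'I_s -> M) :
  is_submodule N -> (forall j, N (h j)) -> lspan h `<=` N.
Proof. by move=> subN Nh _ [a ->]; apply: submodule_sum. Qed.

Lemma local_add1_invertible a : is_local A -> nonunits A a -> invertible (1 - a).
Proof.
move=> [_ addA _] na; apply: contrapT => n1a.
by apply: (@nonunitsN1 A); rewrite -(subrK a 1); apply: addA.
Qed.

(** As [1 - t * a ord0] is a unit, [h ord0] is [t] times a combination of the other vectors, which
    therefore satisfy the hypothesis among themselves. *)
Lemma nakayama t s (h : 'I_s -> M) : is_local A -> nonunits A t ->
  (forall j, exists2 w, lspan h w & h j = t *: w) -> forall j, h j = 0.
Proof.
move=> locA nt; elim: s h => [|s IHs] h ht; first by case.
have [w0 [a def_w0] def_h0] := ht ord0; rewrite big_ord_recl in def_w0.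
set h' := fun k => h (lift ord0 k); pose w' := \sum_k a (lift ord0 k) *: h' k.
have span_w' : lspan h' w' by exists (fun k => a (lift ord0 k)).
have [|u inv_u] := @local_add1_invertible (t * a ord0) locA.
  by rewrite mulrC; apply: nonunitsM.
have {}def_h0 : h ord0 = t *: (u *: w').
  have : (1 - t * a ord0) *: h ord0 = t *: w'.
    by rewrite scalerBl scale1r -scalerA {1}def_h0 def_w0 scalerDr addrC addKr.
  move/(congr1 ( *:%R u)); rewrite (scalerA u (1 - _)) (mulrC u) inv_u scale1r => ->.
  by rewrite !scalerA mulrC.
have h'0 : forall k, h' k = 0.
  apply: IHs => k; have [w [b def_w] def_hk] := ht (lift ord0 k).
  exists w => //; rewrite big_ord_recl in def_w.
  have [_ spanD spanZ] := lspan_submodule h'.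
  rewrite def_w; apply: spanD; last by exists (fun k => b (lift ord0 k)).
  by rewrite def_h0; do 3!apply: (spanZ).
move=> j; case: (unliftP ord0 j) => [k ->|->]; first exact: h'0.
by rewrite def_h0 /w' big1 ?scaler0 // => k _; rewrite h'0 scaler0.
Qed.

(* Induction on the number of generators: the coefficients of the first
   generator in the elements of [N] form an ideal. *)
Lemma noetherian_submodule s (g : 'I_s -> M) N : noetherian A ->
  is_submodule N -> N `<=` lspan g -> exists r (h : 'I_r -> M), N = lspan h.
Proof.
move=> noethA; elim: s g N => [|s IHs] g N subN Ng; have [N0 ND NZ] := subN.
  exists 0%N, g; apply/seteqP; split=> // v [a ->].
  by rewrite big_ord0.
pose g' k := g (lift ord0 k).
have subg' := lspan_submodule g'; have [g'0 g'D g'Z] := subg'.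
pose I : set A := [set a | exists2 v, N v & lspan g' (v - a *: g ord0)].
have idI : is_ideal I.
  split.
  - by exists 0; rewrite ?scale0r ?subr0.
  - move=> a b [v Nv av] [w Nw bw]; exists (v + w); first exact: ND.
    by rewrite scalerDl opprD addrACA; apply: g'D.
  - move=> a b [v Nv bv]; exists (a *: v); first exact: NZ.
    by rewrite -scalerA -scalerBr; apply: g'Z.
have [e defI] := noethA I idI.
have exv i : exists v, N v /\ lspan g' (v - e`_i *: g ord0) \/ ~ (i < size e)%N.
  have [lti|gei] := ltnP i (size e); last by exists 0; right; apply/negP.
  have : I e`_i.
    rewrite defI; exists (fun k : 'I__ => (k == Ordinal lti)%:R).
    rewrite (bigD1 (Ordinal lti)) //= eqxx mul1r big1 ?addr0 // => k /negbTE ->.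
    by rewrite mul0r.
  by case=> v Nv gv; exists v; left.
have [y Hy] := choice exv; have {Hy}Hy (i : 'I_(size e)) :
    N (y i) /\ lspan g' (y i - e`_i *: g ord0).
  by case: (Hy i) => // /(_ (ltn_ord i)).
have subN' : is_submodule (N `&` lspan g').
  split=> [|v w [? ?] [? ?]|a v [? ?]]; split; by [|apply: ND|apply: g'D|apply: NZ|apply: g'Z].
have [r [h defN']] := IHs g' _ subN' (@subIsetr _ _ _).
exists (size e + r)%N, (fun k : 'I_(size e + r) =>
  match fintype.split k with inl i => y i | inr j => h j end).
set hh := fun k => _; have [hh0 hhD hhZ] := lspan_submodule hh.
have hh_l i : hh (lshift r i) = y i by rewrite /hh (unsplitK (inl i)).
have hh_r i : hh (rshift (size e) i) = h i by rewrite /hh (unsplitK (inr i)).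
apply/seteqP; split=> [v Nv|].
  have [a def_v] := Ng v Nv; rewrite big_ord_recl in def_v.
  have : I (a ord0).
    exists v => //; rewrite def_v addrAC subrr add0r.
    by exists (fun k => a (lift ord0 k)).
  rewrite defI => -[c def_a].
  (* The [c i] express [a ord0] in the generators of [I], so the first generator cancels in this
     difference. *)
  have : lspan h (v - \sum_i c i *: y i).
    rewrite -defN'; split.
      by apply: submoduleB => //; apply: submodule_sum => // i; case: (Hy i).
    have -> : v - \sum_i c i *: y i =
       (v - a ord0 *: g ord0) - \sum_i c i *: (y i - e`_i *: g ord0).
      under [X in _ = _ - X]eq_bigr do rewrite scalerBr scalerA.
      by rewrite sumrB -scaler_suml -def_a opprB addrA subrK.
    apply: submoduleB => //.
      by rewrite def_v addrAC subrr add0r; exists (fun k => a (lift ord0 k)).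
    by apply: submodule_sum => // i; case: (Hy i).
  move=> [b def_b]; rewrite -(subrK (\sum_i c i *: y i) v) def_b.
  apply: hhD; apply: submodule_sum; rewrite ?/lspan //;
    try (by apply: lspan_submodule); move=> i.
    by rewrite -hh_r; apply: lspan_mem.
  by rewrite -hh_l; apply: lspan_mem.
apply: lspan_sub => // k; rewrite /hh; case: (fintype.split k) => i; first by case: (Hy i).
by have : lspan h (h i) by [apply: lspan_mem]; rewrite -defN' => -[].
Qed.

End LinearSpan.

(** * Discrete valuation rings *)

Section DiscreteValuationRing.
Variables (B : comNzRingType) (t : B).
Hypotheses (locB : is_local B) (noethB : noetherian B) (dimB : krull_dim B 1).
Hypothesis (max_t : nonunits B = ideal_gen [:: t]).

Lemma uniformizer_nonunit : nonunits B t.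
Proof. by rewrite max_t; apply/ideal_gen1P; exists 1; rewrite mul1r. Qed.

Lemma nonunit_dvd a : nonunits B a -> exists c, a = c * t.
Proof. by rewrite max_t => /ideal_gen1P. Qed.

(** Nakayama's lemma for [I = t I], applied to finitely many generators of [I] in [B] seen as a
    module over itself. *)
Lemma ideal_eq0 (I : set B) : is_ideal I ->
  (forall a, I a -> exists2 c, I c & a = t * c) -> forall a, I a -> a = 0.
Proof.
move=> idI tI; have [e defI] := noethB idI.
pose h (k : 'I_(size e)) : B^o := e`_k.
have eqI (w : B) : I w -> lspan h w by rewrite defI.
have Ih k : I (h k).
  rewrite defI; exists (fun k' : 'I__ => (k' == k)%:R).
  rewrite (bigD1 k) //= eqxx mul1r big1 ?addr0 // => k' /negbTE ->.
  by rewrite mul0r.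
have h0 : forall k, h k = 0.
  apply: (nakayama locB uniformizer_nonunit) => k.
  by have [w Iw ->] := tI _ (Ih k); exists w => //; apply: eqI.
move=> a; rewrite defI => -[c ->]; rewrite big1 // => k _.
by rewrite -/(h k) h0 mulr0.
Qed.

(* The smaller prime [p 0] of a chain does not contain [t], so [p 0 = t * p 0]
   and [p 0 = 0] by Nakayama's lemma. *)
Lemma dvr_integral (a b : B) : a * b = 0 -> a = 0 \/ b = 0.
Proof.
have [[p [prime_p lt_p]] _] := dimB.
have pr0 := prime_p 0%N isT; have pr1 := prime_p 1%N isT.
have [id0 _ mul0] := pr0; have [[p00 _ p0M] _ _] := pr0.
have p0t : ~ p 0%N t.
  have [sub01 nsub10] := lt_p 0%N isT.
  move=> p0t; apply: nsub10 => c /(prime_nonunits pr1)/nonunit_dvd[d ->].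
  exact: p0M.
have p0_eq0 : forall c, p 0%N c -> c = 0.
  apply: ideal_eq0 => // c p0c.
  have [d defc] := nonunit_dvd (prime_nonunits pr0 p0c).
  exists d; last by rewrite mulrC.
  by move: p0c; rewrite defc => /mul0[].
by move=> ab0; have /mul0[] : p 0%N (a * b) by [rewrite ab0]; move/p0_eq0; [left|right].
Qed.

Lemma uniformizer_neq0 : t <> 0.
Proof.
have [[p [prime_p lt_p]] _] := dimB.
have [sub01 nsub10] := lt_p 0%N isT; have [[p00 _ _] _ _] := prime_p 0%N isT.
move=> t0; apply: nsub10 => c /(prime_nonunits (prime_p 1%N isT))/nonunit_dvd[d ->].
by rewrite t0 mulr0.
Qed.

Lemma dvr_mulX_eq0 n b : t ^+ n * b = 0 -> b = 0.
Proof.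
elim: n => [|n IHn]; first by rewrite mul1r.
by rewrite exprS -mulrA => /dvr_integral[/uniformizer_neq0|/IHn].
Qed.

(** The ideal [J] of elements divisible by all powers of [t] satisfies [J = t J], hence is zero. So
    a largest power of [t] divides [b], and the cofactor is a unit because nonunits are multiples of
    [t]. *)
Lemma dvr_valuation b : b <> 0 -> exists n u, invertible u /\ b = t ^+ n * u.
Proof.
pose J : set B := [set b | forall n, exists c, b = t ^+ n * c].
have idJ : is_ideal J.
  split.
  - by move=> n; exists 0; rewrite mulr0.
  - move=> c d Jc Jd n; have [c' ->] := Jc n; have [d' ->] := Jd n.
    by exists (c' + d'); rewrite mulrDr.
  - by move=> c d Jd n; have [d' ->] := Jd n; exists (c * d'); rewrite mulrCA.
have J0 : forall b, J b -> b = 0.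
  apply: ideal_eq0 => // c Jc; have [d def_c] := Jc 1%N; exists d; last by [].
  move=> n; have [d' def_c'] := Jc n.+1; exists d'; apply/eqP.
  rewrite -subr_eq0; apply/eqP; apply: (@dvr_mulX_eq0 1).
  by rewrite mulrBr -def_c def_c' expr1 exprS mulrA subrr.
move=> b0; have [|n nt mint] := @exists_minimal (fun n => ~ exists c, b = t ^+ n * c).
  by apply: contrapT => /forallNP all_n; apply/b0/J0 => n; apply: contrapT.
(* The least exponent that fails to divide is positive, since [t ^+ 0 = 1]; the valuation is its
   predecessor. *)
case: n nt mint => [[]|n nt mint]; first by exists b; rewrite mul1r.
have /contrapT[c def_b] := mint n (ltnSn n); exists n, c; split=> //.
apply: contrapT => /nonunit_dvd[d def_c]; apply: nt; exists d.
by rewrite def_b def_c exprSr -mulrA (mulrC d).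
Qed.

End DiscreteValuationRing.

(** * Inserting one entry into a finite family *)

Section ExtendOrdinal.
Variables (T : Type) (s : nat) (j0 : 'I_s.+1).

Definition ext_ord (t0 : T) (p : 'I_s -> T) (j : 'I_s.+1) : T :=
  oapp p t0 (unlift j0 j).

Lemma ext_ord_lift t0 p k : ext_ord t0 p (lift j0 k) = p k.
Proof. by rewrite /ext_ord liftK. Qed.

Lemma ext_ord_id t0 p : ext_ord t0 p j0 = t0.
Proof. by rewrite /ext_ord unlift_none. Qed.

End ExtendOrdinal.

(** * The kernel of [z] on a module and the Smith normal form of [z] *)

Section DoubleStructure.
Variables (A B : comNzRingType) (f : {rmorphism A -> B}) (x z : A).
Hypotheses (noethA : noetherian A) (zz : z * z = 0).
Hypothesis (kerf : forall a, f a = 0 <-> exists c, a = c * z).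
Hypothesis (valf : forall a, f a <> 0 ->
  exists n u c, invertible u /\ a = x ^+ n * u + c * z).
Hypothesis (regx : forall n b, f x ^+ n * b = 0 -> b = 0).

Lemma invertible_image_neq0 u : invertible u -> f u <> 0.
Proof.
move=> [w uw] fu0; have : f (u * w) = 0 by rewrite rmorphM fu0 mul0r.
by rewrite uw rmorph1; apply/eqP/oner_neq0.
Qed.

Lemma image_uniformizerX_neq0 n u : invertible u -> f (x ^+ n * u) <> 0.
Proof. by move=> /invertible_image_neq0 fu; rewrite rmorphM rmorphXn => /regx. Qed.

Lemma image_z : f z = 0.
Proof. by apply/kerf; exists 1; rewrite mul1r. Qed.

(** Here [n] is the least valuation of the images, reached at [i0]. The type [T] is arbitrary
    because the Smith normal form needs the coefficients of all elements of a submodule at once. *)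
Lemma family_valuation (T : Type) (a : T -> A) :
  (forall i, f (a i) = 0) \/
  exists n (a' c : T -> A) i0, invertible (a' i0) /\
    forall i, a i = x ^+ n * a' i + c i * z.
Proof.
have [?|/existsNP[i fai]] := pselect (forall i, f (a i) = 0); [by left|right].
pose Q n i := exists u c, invertible u /\ a i = x ^+ n * u + c * z.
have [|n [i0 Qi0] minn] := @exists_minimal (fun n => exists i, Q n i).
  by have [n Qn] := valf fai; exists n, i.
have expair i' : exists p : A * A,
    a i' = x ^+ n * p.1 + p.2 * z /\ (Q n i' -> invertible p.1).
  have [[u [c [inv_u def_a]]]|nQ] := pselect (Q n i').
    by exists (u, c).
  have [/kerf[c def_a]|fa] := pselect (f (a i') = 0).
    by exists (0, c); rewrite mulr0 add0r; split.
  have [m Qm] := valf fa; have [u [c [_ def_a]]] := Qm.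
  have lemn : (n <= m)%N by rewrite leqNgt; apply/negP => /minn; apply; exists i'.
  by exists (x ^+ (m - n) * u, c); rewrite /= mulrA -exprD subnKC.
have [p Hp] := choice expair; exists n, (fst \o p), (snd \o p), i0.
by split=> [|i' /=]; [apply: (Hp i0).2|apply: (Hp i').1].
Qed.

Section Module.
Variable M : lmodType A.
Implicit Types (u v w : M).

(* The length of [A v] is at most 2: its submodules are [0], [A z v] and
   [A v]. *)
Lemma torsion_free_regular v : torsion_free M -> x *: v = 0 -> v = 0.
Proof.
move=> tfM xv; pose N : set M := [set w | exists a, w = a *: v].
have subN : is_submodule N.
  split.
  - by exists 0; rewrite scale0r.
  - by move=> _ _ [a ->] [b ->]; exists (a + b); rewrite scalerDl.
  - by move=> a _ [b ->]; exists (a * b); rewrite scalerA.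
suff finN : finite_length N.
  have Nv : N v by exists 1; rewrite scale1r.
  by move: Nv; rewrite (tfM N subN finN).
have Xv n a : (x ^+ n.+1 * a) *: v = 0.
  by rewrite exprSr mulrAC -scalerA xv scaler0.
have scale_unit a : f a = 0 \/ (exists c, a *: v = (c * z) *: v) \/ invertible a.
  have [|/valf[[|n] [u [c [[w uw] ->]]]]] := pselect (f a = 0); [by left| |]; right.
    (* This is the inverse of [u + c * z], because [z * z = 0]. *)
    right; exists (w - w * w * c * z); rewrite mul1r mulrDl !mulrBr uw.
    have -> : u * (w * w * c * z) = w * c * z by rewrite !mulrA uw mul1r.
    have -> : c * z * (w * w * c * z) = 0.
      by rewrite -[RHS](mulr0 (c * c * w * w)) -zz; ring.
    by rewrite subr0 (mulrC w) (mulrAC c) subrK.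
  by left; exists c; rewrite scalerDl Xv add0r.
have scale_cases a : (exists c, a *: v = (c * z) *: v) \/ invertible a.
  by have [/kerf[c ->]|[]] := scale_unit a; [left; exists c|left|right].
have subz L c : is_submodule L -> L ((c * z) *: v) ->
    (c * z) *: v <> 0 -> L (z *: v).
  move=> [_ _ LZ] Lcz cz0; have [/kerf[d def_c]|[[d def_c]|[w cw]]] := scale_unit c.
  - by case: cz0; rewrite def_c -mulrA zz mulr0 scale0r.
  - case: cz0; rewrite mulrC -scalerA def_c scalerA.
    by rewrite mulrCA zz mulr0 scale0r.
  - by have := LZ w _ Lcz; rewrite scalerA mulrA (mulrC w) cw mul1r.
(* In a chain with three strict steps, [L 1] contains [z *: v] and then [L 2] contains all multiples
   of [v], leaving no room for [L 3]. *)
exists 2%N => r L subL ltL; rewrite leqNgt; apply/negP => lt2r.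
have lt1r := ltnW lt2r; have lt0r := ltnW lt1r.
have [_ /existsNP[w0 /not_implyP[L1w0 nL0w0]]] := ltL _ lt0r.
have [[L00 _ _] _] := subL _ (ltnW lt0r).
have [subL1 L1N] := subL _ lt0r; have [_ _ L1Z] := subL1.
have L1z : L 1%N (z *: v).
  have [a def_w0] := L1N _ L1w0; rewrite def_w0 in L1w0 nL0w0.
  have [[c def_av]|[b ab]] := scale_cases a; last first.
    by have := L1Z (z * b) _ L1w0; rewrite scalerA -mulrA (mulrC b) ab mulr1.
  by rewrite def_av in L1w0 nL0w0; apply: subz L1w0 _ => // cz0; rewrite cz0 in nL0w0.
have [_ /existsNP[w1 /not_implyP[L2w1 nL1w1]]] := ltL _ lt1r.
have [[_ _ L2Z] L2N] := subL _ lt1r.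
have [_ []] := ltL _ lt2r => w /((subL _ lt2r).2) [c ->].
have [a def_w1] := L2N _ L2w1; rewrite def_w1 in L2w1 nL1w1.
have [[d def_av]|[b ab]] := scale_cases a.
  by case: nL1w1; rewrite def_av -scalerA; apply: L1Z.
by have := L2Z (c * b) _ L2w1; rewrite scalerA -mulrA (mulrC b) ab mulr1.
Qed.

Hypothesis (regM : forall v, x *: v = 0 -> v = 0).

Lemma scalerX_eq0 n v : x ^+ n *: v = 0 -> v = 0.
Proof.
by elim: n => [|n IHn]; rewrite ?scale1r // exprS -scalerA => /regM/IHn.
Qed.

Definition zkernel : set M := [set v | z *: v = 0].

Lemma zkernel_submodule : is_submodule zkernel.
Proof.
rewrite /zkernel; split=> /= [|u v zu zv|a u zu]; first by rewrite scaler0.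
  by rewrite scalerDr zu zv addr0.
by rewrite scalerA mulrC -scalerA zu scaler0.
Qed.

Lemma zkernel_scale a v : zkernel v -> f a = 0 -> a *: v = 0.
Proof. by move=> zv /kerf[c ->]; rewrite -scalerA zv scaler0. Qed.

(** Linear independence modulo the kernel of [f], with coefficients in [A] so that [zkernel] need
    not be given a [B]-module structure. *)
Definition free_mod_z s (h : 'I_s -> M) :=
  forall a : 'I_s -> A, \sum_j a j *: h j = 0 -> forall j, f (a j) = 0.

Lemma zkernel_family s (h : 'I_s -> M) a n a' c : (forall j, zkernel (h j)) ->
  (forall j, a j = x ^+ n * a' j + c j * z) ->
  \sum_j a j *: h j = x ^+ n *: \sum_j a' j *: h j.
Proof.
move=> zh def_a; rewrite scaler_sumr; apply: eq_bigr => j _.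
by rewrite def_a scalerDl scalerA -(scalerA (c j)) zh scaler0 addr0.
Qed.

Lemma lspan_ext s (h : 'I_s.+1 -> M) j0 a0 (a : 'I_s -> A) :
  \sum_j ext_ord j0 a0 a j *: h j = a0 *: h j0 + \sum_k a k *: h (lift j0 k).
Proof.
rewrite (bigD1_ord j0) //= ext_ord_id; congr (_ + _).
by apply: eq_bigr => k _; rewrite ext_ord_lift.
Qed.

(* A generating family of minimal size is free: a relation, divided by a power
   of [x], expresses one generator in terms of the others. *)
Lemma zkernel_free_basis : finitely_generated M ->
  exists s (h : 'I_s -> M), zkernel = lspan h /\ free_mod_z h.
Proof.
move=> [r [g gP]].
have [|s [h def_h] mins] := @exists_minimal
    (fun s => exists h : 'I_s -> M, zkernel = lspan h).
  by apply: noetherian_submodule zkernel_submodule _ => // v _; apply: gP.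
exists s, h; split=> // a ah0.
have zh j : zkernel (h j) by rewrite def_h; apply: lspan_mem.
have [//|[n [a' [c [j0 [[w aw] def_a]]]]]] := family_valuation a.
have /scalerX_eq0 a'h0 : x ^+ n *: \sum_j a' j *: h j = 0.
  by rewrite -(zkernel_family zh def_a).
case: s => [|s] in h def_h mins a ah0 zh a' c j0 aw def_a a'h0 *; first by case: j0 aw.
case: (mins s (ltnSn s)); exists (fun k => h (lift j0 k)).
rewrite def_h; apply/seteqP; split;
  (apply: lspan_sub => [|j]; first exact: lspan_submodule); last exact: lspan_mem.
case: (unliftP j0 j) => [k ->|->]; first exact: (lspan_mem (fun k => h (lift j0 k))).
exists (fun k => - (w * a' (lift j0 k))).
move: a'h0; rewrite (bigD1_ord j0) //= => /(congr1 ( *:%R w)).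
rewrite scaler0 scalerDr scalerA (mulrC w) aw scale1r => /eqP.
rewrite addr_eq0 => /eqP->; rewrite scaler_sumr -sumrN.
by apply: eq_bigr => k _; rewrite scalerA scaleNr.
Qed.

(* Smith normal form of the multiplication by [z]: a generator of [T] whose
   image has minimal valuation is split off together with that image. *)
Lemma adapted_basis s (h : 'I_s -> M) (T : set M) :
    (forall j, zkernel (h j)) -> free_mod_z h ->
    is_submodule T -> (forall v, T v -> lspan h (z *: v)) ->
  exists (h' e : 'I_s -> M) (d : 'I_s -> option nat),
    [/\ lspan h' = lspan h, free_mod_z h',
        forall j, if d j is Some n then z *: e j = x ^+ n *: h' j else e j = 0
      & forall v, T v -> exists a : 'I_s -> A, zkernel (v - \sum_j a j *: e j)].
Proof.
elim: s h T => [|s IHs] h T zh freeh subT zT.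
  exists h, h, (fun=> None); split=> // [[]//|v /zT[a def_zv]].
  by exists a; rewrite big_ord0 subr0 /zkernel /= def_zv big_ord0.
have exb v : exists b : 'I_s.+1 -> A, T v -> z *: v = \sum_j b j *: h j.
  have [/zT[b def_zv]|nTv] := pselect (T v); first by exists b.
  by exists (fun=> 0).
have [b Hb] := choice exb.
(* The value 0 outside [T] forces the least valuation to be reached at an element [v0] of [T]. *)
pose b1 (p : M * 'I_s.+1) := if `[< T p.1 >] then b p.1 p.2 else 0.
have b1T v j : T v -> b1 (v, j) = b v j by rewrite /b1 /= => /asboolT ->.
have [b0|[n [a' [c [[v0 j0] [inv_a' def_b]]]]]] := family_valuation b1.
  exists h, (fun=> 0), (fun=> None); split=> // v Tv; exists (fun=> 0).
  rewrite big1 ?subr0 => [|j _]; last by rewrite scaler0.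
  rewrite /zkernel /= (Hb _ Tv) big1 // => j _.
  by apply: zkernel_scale => //; rewrite -(b1T v).
have Tv0 : T v0.
  apply: contrapT => nTv0; apply: (image_uniformizerX_neq0 (n := n) inv_a').
  have := def_b (v0, j0); rewrite /b1 /= (asboolF nTv0).
  by move/(congr1 f); rewrite rmorph0 rmorphD (rmorphM _ (c _)) image_z mulr0 addr0.
have zE v : T v -> z *: v = x ^+ n *: \sum_j a' (v, j) *: h j.
  move=> Tv; rewrite (Hb _ Tv) -(@zkernel_family _ _ (b v) n _ (fun j => c (v, j))) //.
  by move=> j; rewrite -def_b b1T.
have [w a'w] := inv_a'; set k := fun i => h (lift j0 i).
(* Now [z *: v0 = x ^+ n *: h1], and [h1] can replace [h j0] in the basis since its coefficient
   there is a unit. *)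
pose h1 := \sum_j a' (v0, j) *: h j.
have h1E : h1 = a' (v0, j0) *: h j0 + \sum_i a' (v0, lift j0 i) *: k i.
  by rewrite /h1 (bigD1_ord j0).
(* The induction treats the elements whose product with [z] needs no [h j0]. *)
pose T' : set M := [set v | T v /\ lspan k (z *: v)].
have [T0 TD TZ] := subT; have subk := lspan_submodule k; have [k0 kD kZ] := subk.
have subT' : is_submodule T'.
  split; first by split; rewrite ?scaler0.
    by move=> v v' [Tv kv] [Tv' kv']; split; rewrite ?scalerDr; [apply: TD|apply: kD].
  move=> a v [Tv kv]; split; first exact: TZ.
  by rewrite scalerA mulrC -scalerA; apply: kZ.
have freek : free_mod_z k.
  move=> a ak i; have := freeh (ext_ord j0 0 a).
  by rewrite lspan_ext scale0r add0r => /(_ ak (lift j0 i)); rewrite ext_ord_lift.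
have [h' [e [d [spanh' freeh' He HT']]]] :=
  IHs k T' (fun i => zh _) freek subT' (fun v Tv => Tv.2).
pose h2 := ext_ord j0 h1 h'.
have subh2 := lspan_submodule h2; have [_ h2D h2Z] := subh2.
have subh := lspan_submodule h.
have k_h2 : lspan k `<=` lspan h2.
  rewrite -spanh'; apply: lspan_sub => // i.
  by rewrite -(ext_ord_lift j0 h1 h'); apply: lspan_mem.
have h1_h2 : lspan h2 h1 by rewrite -[X in lspan _ X](ext_ord_id j0 h1 h'); apply: lspan_mem.
have k_h : lspan k `<=` lspan h by apply: lspan_sub => // i; apply: lspan_mem.
have span_h2 : lspan h2 = lspan h.
  apply/seteqP; split; apply: lspan_sub => // j; case: (unliftP j0 j) => [i|] ->.
  - by rewrite /h2 ext_ord_lift; apply: k_h; rewrite -spanh'; apply: lspan_mem.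
  - by rewrite /h2 ext_ord_id; exists (fun j => a' (v0, j)).
  - by apply: k_h2; apply: (lspan_mem k).
  - have -> : h j0 = w *: (h1 - \sum_i a' (v0, lift j0 i) *: k i).
      by rewrite h1E addrK scalerA mulrC a'w scale1r.
    by apply: h2Z; apply: submoduleB => //; apply: k_h2; exists (fun i => a' (v0, lift j0 i)).
exists h2, (ext_ord j0 v0 e), (ext_ord j0 (Some n) d); split=> //.
- move=> a; rewrite (bigD1_ord j0) //= /h2 ext_ord_id.
  under eq_bigr do rewrite ext_ord_lift.
  set y := \sum_i _ => ah0.
  have [g def_y] : lspan k y by rewrite -spanh'; exists (fun i => a (lift j0 i)).
  (* Once [h1] is expanded, the coefficient of [h j0] in the relation is [a j0] times a unit. *)
  have fa0 : f (a j0) = 0.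
    have := freeh (fun j => a j0 * a' (v0, j) + ext_ord j0 0 g j).
    under eq_bigr do rewrite scalerDl -scalerA.
    rewrite big_split /= -scaler_sumr -/h1 lspan_ext scale0r add0r -def_y.
    move=> /(_ ah0 j0); rewrite ext_ord_id addr0 => faa'.
    by rewrite -[a j0]mulr1 -a'w mulrA rmorphM faa' mul0r.
  move=> j; case: (unliftP j0 j) => [i|] -> //.
  apply: (freeh' (fun i => a (lift j0 i))); rewrite -[RHS]ah0.
  rewrite zkernel_scale ?add0r //.
  by apply: submodule_sum => //; apply: zkernel_submodule.
- move=> j; case: (unliftP j0 j) => [i|] ->.
    by rewrite /h2 !ext_ord_lift; apply: He.
  by rewrite /h2 !ext_ord_id zE.
(* With this [q] the coefficient of [h j0] in [z *: (v - q *: v0)] cancels. *)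
- move=> v Tv; pose q := a' (v, j0) * w.
  have [|a Ha] := HT' (v - q *: v0).
    split; first by apply: submoduleB => //; apply: TZ.
    rewrite scalerBr scalerA mulrC -scalerA !zE // scalerA (mulrC q) -scalerA -scalerBr.
    apply: kZ; rewrite scaler_sumr -sumrB; exists (fun i => a' (v, lift j0 i) - q * a' (v0, lift j0 i)).
    rewrite (bigD1_ord j0) //= scalerA -mulrA (mulrC w) a'w mulr1 subrr add0r.
    by apply: eq_bigr => i _; rewrite scalerBl scalerA.
  exists (ext_ord j0 q a); rewrite (bigD1_ord j0) //= !ext_ord_id.
  by under eq_bigr do rewrite !ext_ord_lift; rewrite opprD addrA.
Qed.

End Module.
End DoubleStructure.

(** * Comparison of the module with the direct sum *)

Section Classification.
Variables (A B : comNzRingType) (f : {rmorphism A -> B}) (x z : A).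
Hypotheses (noethA : noetherian A) (zz : z * z = 0).
Hypothesis (kerf : forall a, f a = 0 <-> exists c, a = c * z).
Hypothesis (valf : forall a, f a <> 0 ->
  exists n u c, invertible u /\ a = x ^+ n * u + c * z).
Hypothesis (regx : forall n b, f x ^+ n * b = 0 -> b = 0).
Hypothesis (annz : forall c, c * z = 0 -> z = 0 \/ f c = 0).
Hypothesis (surjf : forall b, exists a, f a = b).
Variable M : lmodType A.

Section Coordinates.
Variables (s : nat) (h e : 'I_s -> M) (d : 'I_s -> option nat).
Hypotheses (zh : forall j, zkernel z (h j)) (freeh : free_mod_z f h).
Hypothesis (He : forall j,
  if d j is Some n then z *: e j = x ^+ n *: h j else e j = 0).

Definition combination (a b : 'I_s -> A) : M :=
  \sum_j (a j *: e j + b j *: h j).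

(* [e j] and [h j] are sent to [x ^+ n] and [z] when [d j = Some n], and to [0]
   and [1] in [B] when [d j = None]. *)
Definition null_coord (o : option nat) (a b : A) : Prop :=
  if o is Some n then a * x ^+ n + b * z = 0 else f b = 0.

Lemma combinationB a b a' b' : combination a b - combination a' b' =
  combination (fun j => a j - a' j) (fun j => b j - b' j).
Proof.
rewrite -sumrB; apply: eq_bigr => j _.
by rewrite !scalerBl opprD addrACA.
Qed.

(** Applying [f] and cancelling [f x ^+ n] puts [a] in [(z)]; the relation then reads
    [(c * x ^+ n + b) * z = 0], to which [annz] applies. *)
Lemma null_coordP n a b : z <> 0 ->
  null_coord (Some n) a b -> exists2 c, a = c * z & f (c * x ^+ n + b) = 0.
Proof.
move=> z0 /= ab0; have /kerf[c def_a] : f a = 0.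
  apply: (@regx n); have := congr1 f ab0; rewrite rmorphD !rmorphM rmorph0 rmorphXn.
  by rewrite (image_z kerf) mulr0 addr0 mulrC.
exists c => //; have [|//|//] := @annz (c * x ^+ n + b).
by rewrite -ab0 def_a mulrDl mulrAC.
Qed.

(** Multiplying a relation by [z] leaves only the [x ^+ n *: h j], so freeness puts [a j] in [(z)]
    whenever [d j = Some n]. With [a j = c j * z] the relation involves only the [h j], and freeness
    applies again. *)
Lemma combination_eq0 a b :
  combination a b = 0 <-> forall j, null_coord (d j) (a j) (b j).
Proof.
split=> [ab0|ab0]; last first.
  rewrite /combination big1 // => j _; have := ab0 j; have := He j.
  case: (d j) => [n ze|->].
    have z0 : z <> 0.
      (* If [z = 0], then [x ^+ n *: h j = z *: e j = 0], against freeness. *)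
      move=> z0; have := freeh (a := fun i => (i == j)%:R * x ^+ n).
      rewrite (bigD1 j) //= eqxx mul1r -ze z0 scale0r add0r big1; last first.
        by move=> i /negbTE->; rewrite mul0r scale0r.
      move=> /(_ erefl j); rewrite eqxx mul1r -[x ^+ n]mulr1.
      by apply: (image_uniformizerX_neq0 regx); exists 1; rewrite mulr1.
    move=> /(null_coordP z0)[c -> fc]; rewrite -scalerA ze scalerA -scalerDl.
    exact: (zkernel_scale kerf).
  by rewrite scaler0 add0r; apply: (zkernel_scale kerf).
pose a1 j := if d j is Some n then a j * x ^+ n else 0.
have fa1 : forall j, f (a1 j) = 0.
  apply: freeh; rewrite -[RHS](scaler0 _ z) -[X in _ = _ *: X]ab0 scaler_sumr; apply: eq_bigr => j _.
  rewrite scalerDr [z *: (b j *: _)]scalerA (mulrC z) -scalerA zh scaler0 addr0.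
  rewrite scalerA mulrC -scalerA /a1; have := He j.
  by case: (d j) => [n ->|->]; rewrite ?scalerA // !scaler0 scale0r.
have fa j n : d j = Some n -> exists c, a j = c * z.
  move=> dj; apply/kerf/(@regx n); have := fa1 j.
  by rewrite /a1 dj rmorphM rmorphXn mulrC.
have exc j : exists c, forall n, d j = Some n -> a j = c * z.
  case dj: (d j) => [n|]; last by exists 0.
  by have [c ->] := fa j n dj; exists c.
have [c Hc] := choice exc.
pose b1 j := b j + if d j is Some n then c j * x ^+ n else 0.
have fb1 : forall j, f (b1 j) = 0.
  apply: freeh; rewrite -[RHS]ab0; apply: eq_bigr => j _.
  rewrite /b1 scalerDl addrC; congr (_ + _); have := He j; have := Hc j.
  case: (d j) => [n /(_ n erefl) -> ze|_ ->]; last by rewrite scale0r scaler0.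
  by rewrite -scalerA -[in RHS]scalerA ze.
move=> j; have := fb1 j; have := Hc j; rewrite /b1 /null_coord.
case: (d j) => [n /(_ n erefl) ->|_]; last by rewrite addr0.
move=> /kerf[c' def_b]; have -> : b j = c' * z - c j * x ^+ n by rewrite -def_b addrK.
by rewrite mulrBl -(mulrA c') zz mulr0 sub0r mulrAC subrr.
Qed.

Hypothesis (gen : forall v, exists ab : ('I_s -> A) * ('I_s -> A),
  v = combination ab.1 ab.2).

(** Exponent 0 gives [(1, z) = A], so such indices are counted as copies of [A]; [None] gives the
    copies of [B]. *)
Let P1 := [pred j | if d j is Some n then (0 < n)%N else false].
Let P2 := [pred j | d j == Some 0%N].
Let P3 := [pred j | d j == None].

(** By [combination_eq0], [psi] and [combination] have the same kernel. Hence [phi] does not depend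
    on the chosen coefficients, which makes it linear, and it is injective. *)
Lemma isom_direct_sum_coordinates : exists (m q p : nat) (n : 'I_p -> nat),
    (forall l, (0 < n l)%N) /\
    isom_direct_sum f M (fun l => ideal_gen [:: x ^+ n l; z]) m q.
Proof.
pose n (l : 'I_#|P1|) := odflt 0%N (d (enum_val l)).
have dP1 l : d (enum_val l) = Some (n l).
  by have := enum_valP l; rewrite inE /n; case: (d _).
have n_gt0 l : (0 < n l)%N by have := enum_valP l; rewrite inE dP1.
have dP2 (l : 'I_#|P2|) : d (enum_val l) = Some 0%N.
  by have := enum_valP l; rewrite inE => /eqP.
have dP3 (l : 'I_#|P3|) : d (enum_val l) = None.
  by have := enum_valP l; rewrite inE => /eqP.
exists #|P2|, #|P3|, #|P1|, n; split=> //.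
have [co Hab] := choice gen.
pose alpha v := (co v).1; pose beta v := (co v).2.
pose W := ({ffun 'I_#|P1| -> A^o} * {ffun 'I_#|P2| -> A^o} *
           {ffun 'I_#|P3| -> restrict_scalars f})%type.
pose psi (a b : 'I_s -> A) : W :=
  ([ffun l => a (enum_val l) * x ^+ n l + b (enum_val l) * z],
   [ffun l => a (enum_val l) + b (enum_val l) * z],
   [ffun l => f (b (enum_val l))]).
have psi_linear t a b a' b' :
    psi (fun j => t * a j + a' j) (fun j => t * b j + b' j) =
    t *: psi a b + psi a' b'.
  congr ((_, _), _); apply/ffunP => l; rewrite !ffunE /=.
  - by rewrite /GRing.scale /=; ring.
  - by rewrite /GRing.scale /=; ring.
  - by rewrite rmorphD rmorphM.
have psi_eq0 a b : psi a b = 0 <-> combination a b = 0.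
  rewrite combination_eq0; split=> [ab0 j|ab0].
    case dj: (d j) => [[|k]|].
    - have Pj : j \in P2 by rewrite inE dj.
      have := congr1 (fun w : W => w.1.2 (enum_rank_in Pj j)) ab0.
      by rewrite !ffunE enum_rankK_in //= mulr1.
    - have Pj : j \in P1 by rewrite inE dj.
      have := congr1 (fun w : W => w.1.1 (enum_rank_in Pj j)) ab0.
      by rewrite !ffunE /n enum_rankK_in //= dj.
    - have Pj : j \in P3 by rewrite inE dj.
      have := congr1 (fun w : W => w.2 (enum_rank_in Pj j)) ab0.
      by rewrite !ffunE enum_rankK_in.
  congr ((_, _), _); apply/ffunP => l; rewrite !ffunE.
  - by have := ab0 (enum_val l); rewrite dP1.
  - by have := ab0 (enum_val l); rewrite dP2 /= mulr1.
  - by have := ab0 (enum_val l); rewrite dP3.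
pose phi v := psi (alpha v) (beta v).
have psiB a b a' b' : psi a b - psi a' b' =
    psi (fun j => a j - a' j) (fun j => b j - b' j).
  have -> : (fun j => a j - a' j) = (fun j => -1 * a' j + a j).
    by apply/funext => j; rewrite mulN1r addrC.
  have -> : (fun j => b j - b' j) = (fun j => -1 * b' j + b j).
    by apply/funext => j; rewrite mulN1r addrC.
  by rewrite psi_linear scaleN1r addrC.
have psi_eq a b a' b' : psi a b = psi a' b' <-> combination a b = combination a' b'.
  split=> /eqP; rewrite -subr_eq0 => /eqP ab.
    by apply/eqP; rewrite -subr_eq0 combinationB; apply/eqP/psi_eq0; rewrite -psiB.
  by apply/eqP; rewrite -subr_eq0 psiB; apply/eqP/psi_eq0; rewrite -combinationB.
have phiE a b : phi (combination a b) = psi a b.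
  by apply/psi_eq; rewrite -Hab.
have phi_linear : linear phi.
  move=> t u v; rewrite -psi_linear -phiE; congr phi.
  rewrite {1}(Hab u) {1}(Hab v) scaler_sumr -big_split /=.
  apply: eq_bigr => j _; rewrite scalerDr !scalerA !scalerDl.
  by rewrite addrACA.
pose Phi := GRing.isLinear.Build A M W *:%R phi phi_linear.
pose phiL : {linear M -> W} := HB.pack phi Phi.
exists phiL; split=> [u v /psi_eq|]; first by rewrite -!Hab.
apply/seteqP; split=> [_ [v _ <-] l|w Hw].
  by rewrite ffunE; apply/ideal_gen2P; exists (alpha v (enum_val l)), (beta v (enum_val l)).
(* A preimage of [w] is found index by index: each [j] lies in one of the three classes, and the
   conditions for the other two are vacuous. *)
have exab j : exists p : A * A,
    [/\ forall l, enum_val l = j -> p.1 * x ^+ n l + p.2 * z = w.1.1 l,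
        forall l, enum_val l = j -> p.1 + p.2 * z = w.1.2 l
      & forall l, enum_val l = j -> f p.2 = w.2 l].
  case dj: (d j) => [[|k]|].
  - have Pj : j \in P2 by rewrite inE dj.
    exists (w.1.2 (enum_rank_in Pj j), 0); split=> l lj.
    + by have := n_gt0 l; have := dP1 l; rewrite lj dj => -[<-].
    + have El : enum_rank_in Pj j = l by apply: enum_val_inj; rewrite enum_rankK_in.
      by rewrite mul0r addr0 -El.
    + by have := dP3 l; rewrite lj dj.
  - have Pj : j \in P1 by rewrite inE dj.
    have /ideal_gen2P[a [b def_w]] := Hw (enum_rank_in Pj j).
    exists (a, b); split=> l lj.
    + have El : enum_rank_in Pj j = l by apply: enum_val_inj; rewrite enum_rankK_in.
      by rewrite -El def_w.
    + by have := dP2 l; rewrite lj dj.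
    + by have := dP3 l; rewrite lj dj.
  - have Pj : j \in P3 by rewrite inE dj.
    have [b fb] := surjf (w.2 (enum_rank_in Pj j)).
    exists (0, b); split=> l lj.
    + by have := dP1 l; rewrite lj dj.
    + by have := dP2 l; rewrite lj dj.
    + have El : enum_rank_in Pj j = l by apply: enum_val_inj; rewrite enum_rankK_in.
      by rewrite fb -El.
have [p Hp] := choice exab.
exists (combination (fst \o p) (snd \o p)) => //=; rewrite phiE.
case: w Hw exab Hp => [[w1 w2] w3] Hw exab Hp.
congr ((_, _), _); apply/ffunP => l; rewrite ffunE;
  case: (Hp (enum_val l)) => H1 H2 H3; [exact: H1|exact: H2|exact: H3].
Qed.

End Coordinates.

Theorem torsion_free_classification : finitely_generated M -> torsion_free M ->
  exists (m q p : nat) (n : 'I_p -> nat),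
    (forall l, (0 < n l)%N) /\
    isom_direct_sum f M (fun l => ideal_gen [:: x ^+ n l; z]) m q.
Proof.
move=> fgM tfM; have regM v := torsion_free_regular zz kerf valf tfM (v := v).
have [s [h0 [def_h0 freeh0]]] := zkernel_free_basis noethA kerf valf regM fgM.
have zh0 j : zkernel z (h0 j) by rewrite def_h0; apply: lspan_mem.
(* Taking all of [M] for [T] is allowed: [z] maps [M] into its kernel since [z * z = 0]. *)
have [||h [e [d [def_h freeh He gen]]]] :=
    adapted_basis kerf valf regx zh0 freeh0 (T := setT).
- by [].
- by move=> v _; rewrite -def_h0 /zkernel /= scalerA zz scale0r.
have zh j : zkernel z (h j) by rewrite def_h0 -def_h; apply: lspan_mem.
apply: (isom_direct_sum_coordinates zh freeh He) => v.
have [a] := gen v I; rewrite def_h0 -def_h => -[b def_v].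
exists (a, b); rewrite /combination big_split /= -def_v addrC subrK //.
Qed.

End Classification.

(** * The local rings of a primitive double curve *)

Section PrimitiveDoubleRing.
Variables (A B : comNzRingType) (f : {rmorphism A -> B}) (x z : A).
Hypotheses (cmA : cohen_macaulay_local A) (regB : regular_local B 1).
Hypothesis (surjf : forall b, exists a, f a = b).
Hypothesis (localf : forall a, invertible (f a) -> invertible a).
Hypothesis (kerz : [set a | f a = 0] = ideal_gen [:: z]).
Hypothesis (sqr0 : forall a b, f a = 0 -> f b = 0 -> a * b = 0).
Hypothesis (max_fx : nonunits B = ideal_gen [:: f x]).

Lemma kernelP a : f a = 0 <-> exists c, a = c * z.
Proof. by rewrite -ideal_gen1P -kerz. Qed.

Lemma uniformizerX_cancel n b : f x ^+ n * b = 0 -> b = 0.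
Proof. by case: regB => locB noethB dimB _; apply: dvr_mulX_eq0. Qed.

(** The unit part of [f a] lifts along [f], and the lift is a unit because [f] is local. *)
Lemma lift_valuation a : f a <> 0 ->
  exists n u c, invertible u /\ a = x ^+ n * u + c * z.
Proof.
case: regB => locB noethB dimB _.
move=> /(dvr_valuation locB noethB dimB max_fx)[n [w [inv_w fa]]].
have [u fu] := surjf w; have [c def_c] : exists c, a - x ^+ n * u = c * z.
  by apply/kernelP; rewrite rmorphB rmorphM rmorphXn fu fa subrr.
exists n, u, c; split; first by apply: localf; rewrite fu.
by rewrite -def_c addrC subrK.
Qed.

Lemma preimage_prime (p : set B) : is_prime p -> is_prime (f @^-1` p).
Proof.
move=> [[p0 pD pM] p1 mulp]; split; last by move=> a b; rewrite /preimage /= rmorphM => /mulp.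
  split; rewrite /preimage /= ?rmorph0 //.
    by move=> a b pa pb; rewrite rmorphD; apply: pD.
  by move=> a b pb; rewrite rmorphM; apply: pM.
by rewrite /preimage /= rmorph1.
Qed.

(** Depth equals dimension, which is positive because a chain of primes of [B] pulls back to [A];
    the first term of a regular sequence of that length will do. *)
Lemma exists_regular_nonunit :
  exists2 r : A, nonunits A r & forall a, r * a = 0 -> a = 0.
Proof.
case: cmA => _ _ [d [_ ndim] [[s size_s [nu_s reg_s]] _]].
case: regB => _ _ [[p [prime_p lt_p]] _] _.
case: s => [|r s] in size_s nu_s reg_s.
  case: ndim; rewrite -size_s; exists (fun k => f @^-1` p k); split=> k ltk.
    by apply: preimage_prime; apply: prime_p.
  have [sub nsub] := lt_p k ltk; split=> [a|sub']; first exact: sub.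
  by apply: nsub => b; have [a <-] := surjf b; apply: sub'.
exists r; first by apply: nu_s; rewrite mem_head.
move=> a ra0; have [|c ->] := reg_s 0%N isT a; last by rewrite big_ord0.
by rewrite /= ra0; exists (fun=> 0); rewrite big_ord0.
Qed.

(* A regular nonunit [x ^+ n * u + c * z] has [n > 0], and its square is a
   multiple of [x]. *)
Lemma uniformizer_regular a : x * a = 0 -> a = 0.
Proof.
have [r nr reg_r] := exists_regular_nonunit.
have zz : z * z = 0 by apply: sqr0; apply/kernelP; exists 1; rewrite mul1r.
(* If [r] lies in [(z)], then [r * r = 0], so [r = 0] by regularity and every element vanishes. *)
have [/kernelP[c def_r]|] := pselect (f r = 0).
  have /reg_r r0 : r * r = 0 by rewrite def_r mulrACA zz mulr0.
  by move=> _; apply: reg_r; rewrite r0 mul0r.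
move=> /lift_valuation[[|n] [u [c [inv_u def_r]]]].
  case: nr; apply: localf; rewrite def_r mul1r rmorphD rmorphM.
  have -> : f z = 0 by apply/kernelP; exists 1; rewrite mul1r.
  have [w uw] := inv_u; rewrite mulr0 addr0; exists (f w).
  by rewrite -rmorphM uw rmorph1.
move=> xa0; apply/reg_r/reg_r; rewrite mulrA def_r.
have -> : (x ^+ n.+1 * u + c * z) * (x ^+ n.+1 * u + c * z) * a =
    (x ^+ n * u) * (x ^+ n.+1 * u + (c * z) *+ 2) * (x * a) + c * c * (z * z) * a.
  by rewrite exprS; ring.
by rewrite xa0 zz !mulr0 mul0r addr0.
Qed.

(** If [f c] is nonzero, [c * z] is [x ^+ n * u * z]; cancelling the unit [u] and the regular
    element [x] leaves [z = 0]. *)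
Lemma annihilator_z c : c * z = 0 -> z = 0 \/ f c = 0.
Proof.
have [|fc cz0] := pselect (f c = 0); [by right|left].
have [n [u [d [[w uw] def_c]]]] := lift_valuation fc.
have zz : z * z = 0 by apply: sqr0; apply/kernelP; exists 1; rewrite mul1r.
have : x ^+ n * z = 0.
  rewrite -[z]mul1r -uw -[RHS](mul0r w) -cz0 def_c mulrDl -(mulrA d) zz mulr0 addr0.
  by ring.
by elim: n {def_c} => [|n IHn]; rewrite ?mul1r // exprS -mulrA => /uniformizer_regular.
Qed.

End PrimitiveDoubleRing.

(** * Passage from the curve to its stalks *)

Theorem mainTheorem9 (R : realType) (C C2 X : lrSpace (R[i]))
    (i : lrMorphism C C2) (j : lrMorphism C2 X)
    (hC2 : projective_primitive_double_curve i j)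
    (P : C) (hP : closed_point P)
    (z : stalk C2 (i P)) (hz : ideal_stalk i P = ideal_gen [:: z])
    (x : stalk C2 (i P))
    (hx : nonunits (stalk C P) = ideal_gen [:: stalk_map i P x])
    (M : lmodType (stalk C2 (i P)))
    (hfg : finitely_generated M) (htf : torsion_free M) :
  exists (m q p : nat) (n : 'I_p -> nat),
    (forall l, (0 < n l)%N) /\
    isom_direct_sum (stalk_map i P) M
      (fun l => ideal_gen [:: x ^+ n l; z]) m q.
Proof.
(* The geometry provides regularity of the stalk of [C], Cohen-Macaulayness of that of [C2],
   surjectivity of the stalk maps of [i], and a kernel of square zero. *)
case: hC2 => -[_ [_ _ smoothC _]] [_ _ /(_ (i P)) cmP] [[_ _ _ surj_i] _ _] _ [_ _ sqr0].
have regP := smoothC P hP; have surjP := surj_i P; have sqrP := sqr0 P.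
have localP : forall a, invertible (stalk_map i P a) -> invertible a.
  exact: stalk_map_local.
have noethA : noetherian (stalk C2 (i P)) by case: cmP.
apply: torsion_free_classification => //.
- by apply: sqrP; rewrite hz; apply/ideal_gen1P; exists 1; rewrite mul1r.
- exact: kernelP.
- exact: (lift_valuation regP surjP localP hz hx).
- exact: (uniformizerX_cancel regP hx).
- exact: (annihilator_z cmP regP surjP localP hz sqrP hx).
Qed.
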